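(* A matrix $M\in\mathbb{R}^{n\times n}$, with $n=2\nu$ even, is an element of $MPS_n$ if and only if $$M=\gamma\sigma_n^T+\sigma_n\delta^T,$$ where (a) in case $\nu$ is even, $\gamma=\begin{pmatrix}\tilde\gamma\\-\tilde\gamma\end{pmatrix}$, $\delta=\begin{pmatrix}\tilde\delta\\-\tilde\delta\end{pmatrix}$ for some $\tilde\gamma,\tilde\delta\in\mathbb{R}^\nu$; (b) in case $\nu$ is odd, $\gamma=\begin{pmatrix}\tilde\gamma\\ \tilde\gamma\end{pmatrix}$, $\delta=\begin{pmatrix}\tilde\delta\\ \tilde\delta\end{pmatrix}$ for some $\tilde\gamma,\tilde\delta\in\{1_\nu\}^\bot\subset\mathbb{R}^\nu$. The vectors $\gamma,\delta$ can be obtained from $M$ as $\gamma=\frac1nM\sigma_n$, $\delta=\frac1nM^T\sigma_n$.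
   Context: $1_\nu\in\mathbb{R}^\nu$ is the all-ones column vector, $\sigma_n\in\mathbb{R}^n$ the column vector with $j$th entry $(-1)^{j-1}$; $X^\bot$ denotes the orthogonal complement of $X\subset\mathbb{R}^\nu$. $MPS_n=M_n\cap P_n\cap S_n$ (weightless most perfect square matrices), where for even $n=2\nu$ and matrices $M\in\mathbb{R}^{n\times n}$ with indices in $\mathbb{Z}_n=\mathbb{Z}/n\mathbb{Z}$ (modulo $n$): $S_n$: there is $w\in\mathbb{R}$ with $\sum_jM_{i,j}=\sum_jM_{j,i}=nw$ for all $i$. $P_n$: $M_{i,j}+M_{i+\nu,j+\nu}=0$ for all $i,j$. $M_n$: $M_{i,j}+M_{i,j+1}+M_{i+1,j}+M_{i+1,j+1}=0$ for all $i,j$, and $\sum_{i,j\in\mathbb{Z}_n}(-1)^{i+j}M_{i,j}=0$. *)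

(* Defs.v *)
From HB Require Import structures.
From mathcomp Require Import all_boot all_order all_algebra.
From mathcomp Require Import classical_sets reals.
Set Implicit Arguments.
Unset Strict Implicit.
Unset Printing Implicit Defensive.
Import Order.TTheory GRing.Theory Num.Theory.
Local Open Scope classical_set_scope.
Local Open Scope ring_scope.

(* The index ring Z/nZ is represented by 'I_n (residues 0, ..., n - 1):
   the residue of i + 1 is [ordS i] and that of i + k is [iter k ordS i].
   The size n = 2 nu is written nu + nu, so that vectors of R^n split into two
   blocks of length nu by [col_mx]. *)

Definition ones (R : realType) (n : nat) : 'cV[R]_n := const_mx 1.

(* Indices start at 0 here, so the exponent j - 1 for j = 1, ..., n becomes j. *)
Definition sigma (R : realType) (n : nat) : 'cV[R]_n := \col_(j < n) (-1) ^+ j.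

Definition orthogonal_complement (R : realType) (n : nat) (X : set 'cV[R]_n) :
  set 'cV[R]_n := [set v | forall u, X u -> u^T *m v = 0].

Definition Smx (R : realType) (nu : nat) : set 'M[R]_(nu + nu) :=
  [set M : 'M[R]_(nu + nu) | exists w : R, forall i,
     \sum_j M i j = (nu + nu)%:R * w /\ \sum_j M j i = (nu + nu)%:R * w].

Definition Pmx (R : realType) (nu : nat) : set 'M[R]_(nu + nu) :=
  [set M : 'M[R]_(nu + nu) | forall i j : 'I_(nu + nu),
     M i j + M (iter nu (@ordS _) i) (iter nu (@ordS _) j) = 0].

Definition Mmx (R : realType) (nu : nat) : set 'M[R]_(nu + nu) :=
  [set M : 'M[R]_(nu + nu) | (forall i j : 'I_(nu + nu),
              M i j + M i (ordS j) + M (ordS i) j + M (ordS i) (ordS j) = 0) /\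
           \sum_(i < nu + nu) \sum_(j < nu + nu) (-1) ^+ (i + j)%N * M i j = 0].

Definition MPS (R : realType) (nu : nat) : set 'M[R]_(nu + nu) :=
  @Mmx R nu `&` @Pmx R nu `&` @Smx R nu.

Definition MPS_vectors (R : realType) (nu : nat)
    (gamma delta : 'cV[R]_(nu + nu)) : Prop :=
  (~~ odd nu -> exists gamma' delta' : 'cV[R]_nu,
     gamma = col_mx gamma' (- gamma') /\ delta = col_mx delta' (- delta')) /\
  (odd nu -> exists gamma' delta' : 'cV[R]_nu,
     [/\ orthogonal_complement [set ones R nu] gamma',
         orthogonal_complement [set ones R nu] delta',
         gamma = col_mx gamma' gamma' & delta = col_mx delta' delta']).

(* Main.v *)
(* The sign twist N i j = (-1)^(i+j) M i j turns the vanishing of the 2 x 2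
   block sums of M into N i j + N k l = N i l + N k j.  Summing this over all k
   and l, where the alternating sum of M kills the second term, gives
   n N i j = (row sum i of N) + (column sum j of N), which is the decomposition
   with gamma = M sigma / n and delta = M^T sigma / n.  Both block conditions (a)
   and (b) say that v (i + nu) = - (-1)^nu v i and that v has sum zero; the
   former makes v orthogonal to sigma. *)
Require Import Defs.
From HB Require Import structures.
From mathcomp Require Import all_boot all_order all_algebra.
From mathcomp Require Import classical_sets reals.
From mathcomp Require Import ring lra.
Set Implicit Arguments.
Unset Strict Implicit.
Unset Printing Implicit Defensive.
Import Order.TTheory GRing.Theory Num.Theory.
Local Open Scope classical_set_scope.
Local Open Scope ring_scope.

(** * Cyclic shifts of indices and alternating signs *)

Lemma val_iter_ordS (n k : nat) (i : 'I_n) :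
  iter k (@ordS n) i = ((i + k) %% n)%N :> nat.
Proof.
elim: k => [|k IHk] /=; first by rewrite addn0 modn_small.
by rewrite IHk -addn1 modnDml addn1 addnS.
Qed.

(** Every index is an iterated successor of 0, so an identity between neighbours spreads to all
    pairs of indices. *)
Lemma ordS_invariant (T : Type) (n : nat) (f : 'I_n -> T) :
  (forall i, f (ordS i) = f i) -> forall i j, f i = f j.
Proof.
move=> fS i j; have n_gt0 : (0 < n)%N := leq_ltn_trans (leq0n i) (ltn_ord i).
have f0 k : f k = f (Ordinal n_gt0).
  have -> : k = iter k (@ordS n) (Ordinal n_gt0).
    by apply: val_inj; rewrite /= val_iter_ordS add0n modn_small.
  by elim: (nat_of_ord k) => [|m IHm] //=; rewrite fS.
by rewrite (f0 i) (f0 j).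
Qed.

Lemma iter_ordS_inj (n k : nat) : injective (iter k (@ordS n)).
Proof. by elim: k => [|k IHk] // i j /= /ordS_inj /IHk. Qed.

Lemma iter_ordS_lshift (nu : nat) (i : 'I_nu) :
  iter nu (@ordS (nu + nu)) (lshift nu i) = rshift nu i.
Proof.
by apply: val_inj; rewrite /= val_iter_ordS modn_small /= ?ltn_add2r // addnC.
Qed.

Lemma iter_ordS_rshift (nu : nat) (i : 'I_nu) :
  iter nu (@ordS (nu + nu)) (rshift nu i) = lshift nu i.
Proof.
apply: val_inj; rewrite /= val_iter_ordS /= addnAC modnDl modn_small //.
exact: ltn_addr.
Qed.

(** The wrap-around from n - 1 to 0 respects the alternation because n = nu + nu is even. *)
Lemma sign_ordS (R : pzRingType) (nu : nat) (i : 'I_(nu + nu)) :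
  (-1) ^+ ordS i = - (-1) ^+ i :> R.
Proof.
have [lt_i|ge_i] := ltnP i.+1 (nu + nu).
  by rewrite /= modn_small // exprS mulN1r.
have eq_i : i.+1 = (nu + nu)%N by apply/eqP; rewrite eqn_leq ge_i ltn_ord.
rewrite /= eq_i modnn expr0.
by rewrite -mulN1r -exprS eq_i exprD -expr2 sqrr_sign.
Qed.

Lemma sign_iter_ordS (R : pzRingType) (nu k : nat) (i : 'I_(nu + nu)) :
  (-1) ^+ iter k (@ordS _) i = (-1) ^+ k * (-1) ^+ i :> R.
Proof.
elim: k => [|k IHk]; first by rewrite mul1r.
by rewrite iterS sign_ordS IHk exprS !mulNr mul1r.
Qed.

(** Reindexing along [h], a bijection of the finite type, shows that the sum equals its own
    opposite. *)
Lemma sum_antiperiodic (R : numDomainType) (I : finType) (h : I -> I)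
    (f : I -> R) :
  injective h -> (forall i, f (h i) = - f i) -> \sum_i f i = 0.
Proof.
move=> h_inj fh; apply/eqP; rewrite -eqNr -sumrN.
by rewrite [X in _ == X](reindex_inj h_inj); apply/eqP/eq_bigr => i _; rewrite fh.
Qed.

Lemma sum_sign (R : numDomainType) (nu : nat) :
  \sum_(i < nu + nu) (-1) ^+ i = 0 :> R.
Proof. exact: sum_antiperiodic (@ordS_inj _) (@sign_ordS _ _). Qed.

(** * A parity-free form of the block conditions *)

Definition MPS_vector (R : realType) (nu : nat) (v : 'cV[R]_(nu + nu)) : Prop :=
  (forall i, v (iter nu (@ordS _) i) 0 = - (-1) ^+ nu * v i 0) /\
  \sum_i v i 0 = 0.

Lemma MPS_vector_even (R : realType) (nu : nat) (v : 'cV[R]_(nu + nu)) :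
  ~~ odd nu -> MPS_vector v <-> exists u, v = col_mx u (- u).
Proof.
move=> even_nu; have sgn_nu : (-1) ^+ nu = 1 :> R.
  by rewrite -signr_odd (negbTE even_nu).
rewrite /MPS_vector sgn_nu; split=> [[v_per _]|[u ->]].
  exists (usubmx v); rewrite -[LHS]vsubmxK; congr col_mx.
  by apply/colP => i; rewrite !mxE -iter_ordS_lshift v_per mulN1r.
have u_per i : col_mx u (- u) (iter nu (@ordS _) i) 0 = - col_mx u (- u) i 0.
  case: (split_ordP i) => j ->.
    by rewrite iter_ordS_lshift col_mxEu col_mxEd mxE.
  by rewrite iter_ordS_rshift col_mxEu col_mxEd mxE opprK.
split=> [i|]; first by rewrite mulN1r.
(* For even nu the shift by nu negates the vector, which forces its sum to vanish. *)
exact: sum_antiperiodic (@iter_ordS_inj _ nu) u_per.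
Qed.

Lemma ones_orthogonalE (R : realType) (n : nat) (u : 'cV[R]_n) :
  orthogonal_complement [set ones R n] u <-> \sum_i u i 0 = 0.
Proof.
have onesE : ((ones R n)^T *m u) 0 0 = \sum_i u i 0.
  by rewrite mxE; apply: eq_bigr => i _; rewrite !mxE mul1r.
split=> [u_orth|sum_u _ ->]; first by rewrite -onesE u_orth // mxE.
by apply/matrixP => i j; rewrite !ord1 onesE sum_u mxE.
Qed.

Lemma MPS_vector_odd (R : realType) (nu : nat) (v : 'cV[R]_(nu + nu)) :
  odd nu -> MPS_vector v <->
  exists2 u, orthogonal_complement [set ones R nu] u & v = col_mx u u.
Proof.
move=> odd_nu; have sgn_nu : (-1) ^+ nu = -1 :> R by rewrite -signr_odd odd_nu.
have sumE (u : 'cV[R]_nu) :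
    \sum_i col_mx u u i 0 = (\sum_i u i 0) *+ 2.
  rewrite big_split_ord mulr2n /=.
  by congr (_ + _); apply: eq_bigr => i _; rewrite (col_mxEu, col_mxEd).
rewrite /MPS_vector sgn_nu opprK; split=> [[v_per sum_v]|[u]].
  have defv : v = col_mx (usubmx v) (usubmx v).
    rewrite -[LHS]vsubmxK; congr col_mx.
    by apply/colP => i; rewrite !mxE -iter_ordS_lshift v_per mul1r.
  exists (usubmx v) => //; apply/ones_orthogonalE/eqP.
  by move/eqP: sum_v; rewrite {1}defv sumE mulrn_eq0.
move=> /ones_orthogonalE sum_u ->; split=> [i|]; last by rewrite sumE sum_u mul0rn.
rewrite mul1r; case: (split_ordP i) => j ->.
  by rewrite iter_ordS_lshift col_mxEu col_mxEd.
by rewrite iter_ordS_rshift col_mxEu col_mxEd.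
Qed.

Lemma MPS_vectorsE (R : realType) (nu : nat) (gamma delta : 'cV[R]_(nu + nu)) :
  MPS_vectors gamma delta <-> MPS_vector gamma /\ MPS_vector delta.
Proof.
rewrite /MPS_vectors; case: (boolP (odd nu)) => [nu_odd|nu_even]; split.
- move=> [_ /(_ isT) [u [v [u_orth v_orth gammaE deltaE]]]].
  by split; apply/(MPS_vector_odd _ nu_odd); [exists u | exists v].
- case=> /(MPS_vector_odd _ nu_odd)[u u_orth gammaE].
  move=> /(MPS_vector_odd _ nu_odd)[v v_orth deltaE].
  by split=> // _; exists u, v.
- move=> [/(_ isT) [u [v [gammaE deltaE]]] _].
  by split; apply/(MPS_vector_even _ nu_even); [exists u | exists v].
- case=> /(MPS_vector_even _ nu_even)[u gammaE].
  move=> /(MPS_vector_even _ nu_even)[v deltaE].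
  by split=> // _; exists u, v.
Qed.

(** Under the shift by nu, [v] gains the factor -(-1)^nu and the sign gains (-1)^nu, so their
    product is antiperiodic for either parity. *)
Lemma MPS_vector_sigma (R : realType) (nu : nat) (v : 'cV[R]_(nu + nu)) :
  MPS_vector v -> \sum_i v i 0 * (-1) ^+ i = 0.
Proof.
move=> [v_per _]; apply: sum_antiperiodic (@iter_ordS_inj _ nu) _ => i.
rewrite v_per sign_iter_ordS !mulNr mulrACA -expr2 sqrr_sign; exact/congr1/mul1r.
Qed.

(** * From the vectors to the matrix *)

Lemma MPS_formE (R : realType) (nu : nat) (gamma delta : 'cV[R]_(nu + nu)) i j :
  (gamma *m (sigma R (nu + nu))^T + sigma R (nu + nu) *m delta^T) i j =
  gamma i 0 * (-1) ^+ j + (-1) ^+ i * delta j 0.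
Proof. by rewrite !mxE !big_ord_recl !big_ord0 !addr0 !mxE. Qed.

(** This symmetry reduces the formula for [delta] to the one for [gamma]. *)
Lemma MPS_form_tr (R : realType) (nu : nat) (gamma delta : 'cV[R]_(nu + nu)) :
  (gamma *m (sigma R (nu + nu))^T + sigma R (nu + nu) *m delta^T)^T =
  delta *m (sigma R (nu + nu))^T + sigma R (nu + nu) *m gamma^T.
Proof. by rewrite linearD /= !trmx_mul !trmxK addrC. Qed.

(** Right multiplication by sigma isolates [gamma], since sigma^T sigma = n and delta^T sigma =
    0. *)
Lemma sigma_coeff (R : realType) (nu : nat) (gamma delta : 'cV[R]_(nu + nu)) :
  (0 < nu)%N -> MPS_vector delta ->
  let M := gamma *m (sigma R (nu + nu))^T + sigma R (nu + nu) *m delta^T in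
  gamma = (nu + nu)%:R^-1 *: (M *m sigma R (nu + nu)).
Proof.
move=> nu_gt0 /MPS_vector_sigma delta_sigma M.
have n_neq0 : (nu + nu)%:R != 0 :> R by rewrite pnatr_eq0 -lt0n addn_gt0 nu_gt0.
suff -> : M *m sigma R (nu + nu) = (nu + nu)%:R *: gamma.
  by rewrite scalerA mulVf // scale1r.
apply/colP => i; rewrite !mxE.
under eq_bigr => j _ do
  rewrite MPS_formE [sigma _ _ _ _]mxE mulrDl -!mulrA -expr2 sqrr_sign mulr1.
by rewrite big_split /= -mulr_sumr delta_sigma mulr0 addr0 sumr_const card_ord
  mulr_natl.
Qed.

Lemma MPS_form_in (R : realType) (nu : nat) (gamma delta : 'cV[R]_(nu + nu)) :
  MPS_vector gamma -> MPS_vector delta ->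
  @MPS R nu (gamma *m (sigma R (nu + nu))^T + sigma R (nu + nu) *m delta^T).
Proof.
move=> gammaP deltaP; split; first split.
- split=> [i j|]; first by rewrite !MPS_formE !sign_ordS; ring.
  have term (i j : 'I_(nu + nu)) :
      (-1) ^+ (i + j)%N * (gamma *m (sigma R (nu + nu))^T
        + sigma R (nu + nu) *m delta^T) i j =
      gamma i 0 * (-1) ^+ i + delta j 0 * (-1) ^+ j.
    (* The squares of the signs stay explicit, so that the identity is polynomial and [ring]
       applies; they are then replaced by 1. *)
    transitivity (gamma i 0 * (-1) ^+ i * (-1) ^+ j ^+ 2
        + delta j 0 * (-1) ^+ j * (-1) ^+ i ^+ 2).
      by rewrite MPS_formE exprD; move: ((-1) ^+ i) ((-1) ^+ j) => a b; ring.
    by rewrite !sqrr_sign !mulr1.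
  under eq_bigr => i _ do under eq_bigr => j _ do rewrite term.
  under eq_bigr => i _ do
    rewrite big_split /= (MPS_vector_sigma deltaP) addr0 sumr_const card_ord.
  by rewrite sumrMnl (MPS_vector_sigma gammaP) mul0rn.
- move=> i j; rewrite !MPS_formE !sign_iter_ordS gammaP.1 deltaP.1.
  have : (-1) ^+ nu ^+ 2 = 1 :> R := sqrr_sign _ nu.
  move: ((-1) ^+ nu) ((-1) ^+ i) ((-1) ^+ j) => c a b c2.
  (* The shift multiplies each vector entry by - c and each sign by c, hence the whole matrix entry
     by - c^2 = -1. *)
  transitivity ((1 - c ^+ 2) * (gamma i 0 * b + a * delta j 0)); first by ring.
  by rewrite c2 subrr mul0r.
- exists 0 => i; rewrite mulr0; split.
    under eq_bigr => j _ do rewrite MPS_formE.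
    by rewrite big_split /= -!mulr_sumr sum_sign deltaP.2 !mulr0 addr0.
  under eq_bigr => j _ do rewrite MPS_formE.
  by rewrite big_split /= -!mulr_suml sum_sign gammaP.2 !mul0r addr0.
Qed.

(** * From the matrix to the vectors *)

Lemma Mmx_decomp (R : realType) (nu : nat) (M : 'M[R]_(nu + nu)) :
  (0 < nu)%N -> @Mmx R nu M ->
  M = ((nu + nu)%:R^-1 *: (M *m sigma R (nu + nu))) *m (sigma R (nu + nu))^T
    + sigma R (nu + nu) *m ((nu + nu)%:R^-1 *: (M^T *m sigma R (nu + nu)))^T.
Proof.
move=> nu_gt0 [blockM altM].
have n_neq0 : (nu + nu)%:R != 0 :> R by rewrite pnatr_eq0 -lt0n addn_gt0 nu_gt0.
have sign_sq k : (-1) ^+ k * (-1) ^+ k = 1 :> R by rewrite -expr2 sqrr_sign.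
pose N (i j : 'I_(nu + nu)) := (-1) ^+ i * (-1) ^+ j * M i j.
(* The mixed second difference of [N] is (-1)^(i+j) times a 2 x 2 block sum of [M]. Invariance along
   columns, then along rows, extends this to arbitrary rectangles. *)
have NS i j : N (ordS i) (ordS j) - N i (ordS j) = N (ordS i) j - N i j.
  apply/eqP; rewrite -subr_eq0 /N !sign_ordS; apply/eqP.
  by rewrite -[RHS](mulr0 ((-1) ^+ i * (-1) ^+ j)) -(blockM i j); ring.
have Nrow i j l : N (ordS i) j - N (ordS i) l = N i j - N i l.
  have := ordS_invariant (NS i) j l; lra.
have Ncross i j k l : N i j + N k l = N i l + N k j.
  have := ordS_invariant (fun i => Nrow i j l) i k; lra.
have sumN : \sum_i \sum_j N i j = 0.
  rewrite -[RHS]altM; apply: eq_bigr => i _; apply: eq_bigr => j _.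
  by rewrite exprD.
have NE i j : (nu + nu)%:R * N i j = \sum_l N i l + \sum_k N k j.
  (* The double sum counts [N i j] n^2 times and the row and column sums n times each, so one factor
     n is restored before comparing. *)
  apply: (mulfI n_neq0).
  have : \sum_k \sum_l (N i j + N k l) = \sum_k \sum_l (N i l + N k j).
    by apply: eq_bigr => k _; apply: eq_bigr => l _.
  under eq_bigr => k _ do rewrite big_split /= sumr_const card_ord.
  under [RHS]eq_bigr => k _ do rewrite big_split /= sumr_const card_ord.
  rewrite !big_split /= sumN addr0 !sumr_const card_ord sumrMnl.
  by rewrite !mulr_natl mulrnDl => ->.
have rowE i : \sum_l N i l = (-1) ^+ i * (M *m sigma R (nu + nu)) i 0.
  rewrite mxE mulr_sumr; apply: eq_bigr => l _.
  by rewrite /N mxE -mulrA [_ * M i l]mulrC.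
have colE j : \sum_k N k j = (-1) ^+ j * (M^T *m sigma R (nu + nu)) j 0.
  rewrite mxE mulr_sumr; apply: eq_bigr => k _.
  by rewrite /N [M^T _ _]mxE [sigma _ _ _ _]mxE mulrA [RHS]mulrC mulrA.
apply/matrixP => i j; rewrite MPS_formE.
rewrite [(_ *: (M *m _)) i 0]mxE [(_ *: (M^T *m _)) j 0]mxE.
have -> : M i j = (-1) ^+ i * (-1) ^+ j * N i j.
  by rewrite /N mulrA mulrACA !sign_sq !mul1r.
apply: (mulfI n_neq0); rewrite mulrCA NE rowE colE.
move: (_ i 0) (_ j 0) => r c; move: (sign_sq i) (sign_sq j).
move: ((-1) ^+ i) ((-1) ^+ j) ((nu + nu)%:R) n_neq0 => a b n n0 a2 b2.
rewrite mulrDr [RHS]mulrDr -[n^-1 * r * b]mulrA mulVKf // [a * (n^-1 * c)]mulrCA.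
rewrite mulVKf //; congr (_ + _).
  (* Inserting a^2 = 1 here, and b^2 = 1 in the other summand, turns the goal into a ring
     identity. *)
  by rewrite [RHS]mulrC -[RHS]mul1r -a2; ring.
by rewrite -[RHS]mul1r -b2; ring.
Qed.

(** [Pmx] yields the behaviour under the shift by nu; the constant column sums from [Smx] give sum
    zero, as sigma sums to zero. Applied to the transpose it also covers [delta]. *)
Lemma MPS_vector_mul_sigma (R : realType) (nu : nat) (M : 'M[R]_(nu + nu)) c :
  @Pmx R nu M -> @Smx R nu M -> MPS_vector (c *: (M *m sigma R (nu + nu))).
Proof.
move=> PM [w sumM]; split=> [i|].
  rewrite !mxE mulrCA; congr (_ * _).
  (* Shifting the column index by nu as well makes [Pmx] applicable entrywise. *)
  rewrite (reindex_inj (@iter_ordS_inj _ nu)) mulr_sumr.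
  apply: eq_bigr => j _; rewrite !mxE sign_iter_ordS.
  by move/eqP: (PM i j); rewrite addrC addr_eq0 => /eqP ->; rewrite mulrCA !mulNr
    mulrN.
under eq_bigr => i _ do rewrite !mxE.
rewrite -mulr_sumr exchange_big /=.
under eq_bigr => j _ do rewrite -mulr_suml (sumM j).2 mxE.
by rewrite -mulr_sumr sum_sign !mulr0.
Qed.

Lemma Pmx_tr (R : realType) (nu : nat) (M : 'M[R]_(nu + nu)) :
  @Pmx R nu M -> @Pmx R nu M^T.
Proof. by move=> PM i j; rewrite !mxE PM. Qed.

Lemma Smx_tr (R : realType) (nu : nat) (M : 'M[R]_(nu + nu)) :
  @Smx R nu M -> @Smx R nu M^T.
Proof.
move=> [w sumM]; exists w => i; have [rowM colM] := sumM i.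
by split; under eq_bigr => j _ do rewrite mxE.
Qed.

Theorem theorem14 (R : realType) (nu : nat) (hnu : (0 < nu)%N)
    (M : 'M[R]_(nu + nu)) :
  (M \in @MPS R nu <->
   exists gamma delta : 'cV[R]_(nu + nu),
     MPS_vectors gamma delta /\
     M = gamma *m (sigma R (nu + nu))^T + sigma R (nu + nu) *m delta^T) /\
  (forall gamma delta : 'cV[R]_(nu + nu),
     MPS_vectors gamma delta ->
     M = gamma *m (sigma R (nu + nu))^T + sigma R (nu + nu) *m delta^T ->
     gamma = (nu + nu)%:R^-1 *: (M *m sigma R (nu + nu)) /\
     delta = (nu + nu)%:R^-1 *: (M^T *m sigma R (nu + nu))).
Proof.
split; first split.
- rewrite inE => -[[MM PM] SM].
  exists ((nu + nu)%:R^-1 *: (M *m sigma R (nu + nu))).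
  exists ((nu + nu)%:R^-1 *: (M^T *m sigma R (nu + nu))).
  split; last exact: Mmx_decomp.
  apply/MPS_vectorsE; split; first exact: MPS_vector_mul_sigma.
  by apply: MPS_vector_mul_sigma; [exact: Pmx_tr | exact: Smx_tr].
- move=> [gamma [delta [/MPS_vectorsE[gammaP deltaP] ->]]].
  by rewrite inE; exact: MPS_form_in.
- move=> gamma delta /MPS_vectorsE[gammaP deltaP] ->; split.
    exact: sigma_coeff.
  by rewrite MPS_form_tr; exact: sigma_coeff.
Qed.
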